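(* Let $p$ be a prime, let $V$ be a left vector space over $\mathbb{Q}_p$, and let $N$ be a norm on $V$. Let $\alpha,\beta$ be two $\mathbb{Q}_p$-linearly independent vectors of $V$, and let $\mathcal{L}=\mathcal{L}(\alpha,\beta)=\mathbb{Z}_p\alpha+\mathbb{Z}_p\beta$ be the lattice of rank 2 in $V$ that they generate. Then there is a deterministic algorithm to find an $N$-orthogonal basis of the lattice $\mathcal{L}$, provided that the norm $N(v)$ of any vector $v\in V$ can be computed efficiently.
   Context: A norm on a $\mathbb{Q}_p$-vector space $V$ is a function $N:V\to\mathbb{R}$ such that (i) $N(v)\ge 0$ for all $v\in V$, with $N(v)=0$ if and only if $v=0$; (ii) $N(xv)=|x|_p\cdot N(v)$ for all $x\in\mathbb{Q}_p$, $v\in V$; (iii) $N(v+w)\le\max(N(v),N(w))$ for all $v,w\in V$. Here $|\cdot|_p$ is the $p$-adic absolute value. For $\mathbb{Q}_p$-linearly independent $v_1,\ldots,v_m\in V$, the $p$-adic lattice with basis $v_1,\ldots,v_m$ is $\mathcal{L}(v_1,\ldots,v_m)=\left\{\sum_{i=1}^m a_iv_i: a_i\in\mathbb{Z}_p\right\}$; $m$ is its rank. A basis $\alpha_1,\ldots,\alpha_m$ of a finite-dimensional $\mathbb{Q}_p$-vector space $U$ with norm $N$ is called $N$-orthogonal if $N\left(\sum_{i=1}^m a_i\alpha_i\right)=\max_{1\le i\le m}N(a_i\alpha_i)$ for all $a_i\in\mathbb{Q}_p$. Vectors $\alpha_1,\ldots,\alpha_m$ form an $N$-orthogonal basis of a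 lattice $\mathcal{L}$ if $\mathcal{L}=\sum_{i=1}^m\mathbb{Z}_p\alpha_i$ and $\alpha_1,\ldots,\alpha_m$ is an $N$-orthogonal basis of the vector space spanned by $\mathcal{L}$ (with the norm $N$ restricted to it). Computational convention: the algorithm is given $\alpha,\beta$ and represents vectors of their span by coordinates with respect to $\alpha,\beta$. The hypothesis that $N(v)$ can be computed efficiently means that the algorithm may call a procedure which, for any vector $v$ it has constructed, returns $N(v)$. Arithmetic in $\mathbb{Q}_p$ and comparison of real numbers are treated as exact single steps. An algorithm is understood to terminate after finitely many steps. *)

(* Defs.v *)
From HB Require Import structures.
From mathcomp Require Import all_boot all_order all_algebra.
From mathcomp Require Import fraction generic_quotient.
From mathcomp Require Import boolp classical_sets reals.

Set Implicit Arguments.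
Unset Strict Implicit.
Unset Printing Implicit Defensive.

Import Order.TTheory GRing.Theory Num.Theory.
Local Open Scope ring_scope.

(* Z_p as the inverse limit of the rings Z/p^n; the residue modulo p^n is
   represented by an integer in [0, p^n[. *)
Record padic_int (p : nat) (pp : prime p) := PadicInt {
  residue : nat -> int;
  residue_compat :
    forall n, residue n = (residue n.+1 %% (p ^ n)%N)%Z
}.

Section PadicInt.
Context (p : nat) (pp : prime p).
Local Notation Zp := (padic_int pp).
Local Notation q n := ((p ^ n)%N : int).

Lemma residue_inj : injective (@residue p pp).
Proof.
case=> f cf [g cg] /= efg; rewrite efg in cf *.
by rewrite (Prop_irrelevance cf cg).
Qed.

HB.instance Definition _ := gen_eqMixin Zp.
HB.instance Definition _ := gen_choiceMixin Zp.

Lemma padic_dvd_succ n : (q n %| q n.+1)%Z.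
Proof. by rewrite dvdzE /= expnS dvdn_mull. Qed.

Lemma modz_pS m n : ((m %% q n.+1)%Z = m %[mod q n])%Z.
Proof.
have /dvdzP[c ->] := padic_dvd_succ n.
by rewrite {2}(divz_eq m (c * q n)) mulrA modzMDl.
Qed.

Lemma residue_mod (x : Zp) n : (residue x n %% q n)%Z = residue x n.
Proof. by rewrite [in LHS]residue_compat modz_mod -residue_compat. Qed.

Lemma padic_limit_subproof (f : nat -> int) :
  (forall n, (f n.+1 = f n %[mod q n])%Z) ->
  forall n, (f n %% q n)%Z = ((f n.+1 %% q n.+1)%Z %% q n)%Z.
Proof. by move=> cf n; rewrite modz_pS cf. Qed.

Definition padic_limit (f : nat -> int)
    (cf : forall n, (f n.+1 = f n %[mod q n])%Z) : Zp :=
  PadicInt pp (padic_limit_subproof cf).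

Lemma residueS (x : Zp) n : (residue x n.+1 = residue x n %[mod q n])%Z.
Proof. by rewrite -residue_compat residue_mod. Qed.

Lemma padic_const_subproof (m : int) n : (m = m %[mod q n])%Z.
Proof. by []. Qed.

Lemma padic_add_subproof (x y : Zp) n :
  (residue x n.+1 + residue y n.+1 = residue x n + residue y n %[mod q n])%Z.
Proof. by rewrite -modzDm !residueS modzDm. Qed.

Lemma padic_opp_subproof (x : Zp) n :
  (- residue x n.+1 = - residue x n %[mod q n])%Z.
Proof. by rewrite -modzNm residueS modzNm. Qed.

Lemma padic_mul_subproof (x y : Zp) n :
  (residue x n.+1 * residue y n.+1 = residue x n * residue y n %[mod q n])%Z.
Proof. by rewrite -modzMm !residueS modzMm. Qed.

Definition padic_const (m : int) : Zp := padic_limit (padic_const_subproof m).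
Definition padic_add x y : Zp := padic_limit (padic_add_subproof x y).
Definition padic_opp x : Zp := padic_limit (padic_opp_subproof x).
Definition padic_mul x y : Zp := padic_limit (padic_mul_subproof x y).

Lemma padic_eqP (x y : Zp) : (forall n, residue x n = residue y n) -> x = y.
Proof. by move=> exy; apply/residue_inj/funext. Qed.

Lemma padic_addA : associative padic_add.
Proof.
by move=> x y z; apply: padic_eqP => n /=; rewrite modzDmr modzDml addrA.
Qed.
Lemma padic_addC : commutative padic_add.
Proof. by move=> x y; apply: padic_eqP => n /=; rewrite addrC. Qed.
Lemma padic_add0 : left_id (padic_const 0) padic_add.
Proof.
by move=> x; apply: padic_eqP => n /=; rewrite mod0z add0r residue_mod.
Qed.
Lemma padic_addN : left_inverse (padic_const 0) padic_opp padic_add.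
Proof. by move=> x; apply: padic_eqP => n /=; rewrite modzDml addNr. Qed.

HB.instance Definition _ :=
  GRing.isZmodule.Build Zp padic_addA padic_addC padic_add0 padic_addN.

Lemma padic_mulA : associative padic_mul.
Proof.
by move=> x y z; apply: padic_eqP => n /=; rewrite modzMmr modzMml mulrA.
Qed.
Lemma padic_mulC : commutative padic_mul.
Proof. by move=> x y; apply: padic_eqP => n /=; rewrite mulrC. Qed.
Lemma padic_mul1 : left_id (padic_const 1) padic_mul.
Proof.
by move=> x; apply: padic_eqP => n /=; rewrite modzMml mul1r residue_mod.
Qed.
Lemma padic_mulDl : left_distributive padic_mul padic_add.
Proof.
move=> x y z; apply: padic_eqP => n /=.
by rewrite modzMml modzDml modzDmr mulrDl.
Qed.
Lemma padic_oner_neq0 : padic_const 1 != 0.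
Proof.
apply/eqP => /(congr1 (@residue p pp)) /(congr1 (@^~ 1%N)) /=.
rewrite expn1 mod0z modz_small // ler01 /=.
by rewrite ltz_nat prime_gt1.
Qed.

HB.instance Definition _ := GRing.Zmodule_isComNzRing.Build Zp
  padic_mulA padic_mulC padic_mul1 padic_mulDl padic_oner_neq0.

Definition padic_unit : pred Zp := fun x => `[< exists y : Zp, y * x = 1 >].
Definition padic_inv (x : Zp) : Zp :=
  if pselect (exists y : Zp, y * x = 1) is left ex then projT1 (cid ex) else x.

Lemma padic_mulVr : {in padic_unit, left_inverse 1 padic_inv *%R}.
Proof.
move=> x /asboolP ex; rewrite /padic_inv; case: pselect => // ex'.
by case: cid.
Qed.
Lemma padic_unitP (x y : Zp) : y * x = 1 -> padic_unit x.
Proof. by move=> yx; apply/asboolP; exists y. Qed.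
Lemma padic_inv_out : {in [predC padic_unit], padic_inv =1 id}.
Proof.
move=> x /negP nx; rewrite /padic_inv; case: pselect => // ex.
by case: nx; apply/asboolP.
Qed.

HB.instance Definition _ := GRing.ComNzRing_hasMulInverse.Build Zp
  padic_mulVr padic_unitP padic_inv_out.

Lemma residue_dvd (x : Zp) m n :
  (m <= n)%N -> (q m %| residue x n)%Z = (residue x m == 0).
Proof.
move=> /subnK <-; elim: (n - m)%N => [|k IHk].
  by rewrite add0n -[in RHS]residue_mod; apply/dvdz_mod0P/eqP.
rewrite -IHk addSn.
have qd : (q m %| q (k + m))%Z by rewrite dvdzE /= dvdn_exp2l // leq_addl.
have := divz_eq (residue x (k + m).+1) (q (k + m)).
rewrite -residue_compat => ->.
by rewrite rpredDl // dvdz_mull.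
Qed.

Lemma padic_neq0 (x : Zp) : x != 0 ->
  exists n, residue x n = 0 /\ residue x n.+1 != 0.
Proof.
move=> /eqP x0; apply: contrapT => H; apply: x0; apply: padic_eqP => n /=.
rewrite mod0z; elim: n => [|n IHn].
  by rewrite -residue_mod expn0 modz1.
by apply/eqP/negP => /negP nz; apply: H; exists n; rewrite IHn.
Qed.

(* x is exactly divisible by p^n, where n = padic_val x (0 if x = 0) *)
Definition padic_val (x : Zp) : nat :=
  xget 0%N [set n | residue x n = 0 /\ residue x n.+1 != 0]%classic.

Lemma padic_valP (x : Zp) n : x != 0 ->
  padic_val x = n <-> residue x n = 0 /\ residue x n.+1 != 0.
Proof.
move=> /padic_neq0 [m [m0 m1]]; rewrite /padic_val; case: xgetP => [k _ [k0 k1]|].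
  split=> [<- //|[n0 n1]]; apply/eqP; rewrite eqn_leq.
  apply/andP; split; rewrite leqNgt; apply/negP => lt.
    by move: n1; rewrite -(residue_dvd _ lt) k0 dvdz0.
  by move: k1; rewrite -(residue_dvd _ lt) n0 dvdz0.
by move=> /(_ m); case.
Qed.

Lemma padic_val_mul_subproof (x y : Zp) m n :
  residue x m = 0 -> residue x m.+1 != 0 ->
  residue y n = 0 -> residue y n.+1 != 0 ->
  residue (x * y) (m + n) = 0 /\ residue (x * y) (m + n).+1 != 0.
Proof.
move=> x0 x1 y0 y1; set k := (m + n).+1.
have mk : (m < k)%N by rewrite ltnS leq_addr.
have nk : (n < k)%N by rewrite ltnS leq_addl.
move: x0 x1 y0 y1 => /eqP; rewrite -(residue_dvd x (ltnW mk)) => x0.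
rewrite -(residue_dvd x mk) => x1 /eqP; rewrite -(residue_dvd y (ltnW nk)) => y0.
rewrite -(residue_dvd y nk) => y1.
have E j : (j <= k)%N -> (residue (x * y) j == 0) =
    (q j %| residue x k * residue y k)%Z.
  move=> jk; rewrite -(residue_dvd _ jk) /=.
  have qd : (q j %| q k)%Z by rewrite dvdzE /= dvdn_exp2l.
  rewrite [in RHS](divz_eq (residue x k * residue y k) (q k)).
  by rewrite [RHS]rpredDl //; apply: dvdz_mull.
have [xn yn] : `|residue x k|%N != 0%N /\ `|residue y k|%N != 0%N.
  by split; rewrite absz_eq0; [apply: contraNneq x1|apply: contraNneq y1] => ->;
     rewrite dvdz0.
have LE j a : `|a|%N != 0%N -> (q j %| a)%Z = (j <= logn p `|a|)%N.
  by move=> a0; rewrite dvdzE /= pfactor_dvdn // lt0n.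
have xyn : `|(residue x k * residue y k)%R|%N != 0%N.
  by rewrite abszM muln_eq0 negb_or xn.
have Lxy : logn p `|(residue x k * residue y k)%R| =
    (logn p `|residue x k| + logn p `|residue y k|)%N.
  by rewrite abszM lognM // lt0n.
rewrite !LE // -!leqNgt in x0 x1 y0 y1.
split; first by apply/eqP; rewrite (E _ (leqnSn _)) LE // Lxy leq_add.
by rewrite (E _ (leqnn k)) LE // Lxy -leqNgt leq_add.
Qed.

Lemma padic_integral (x y : Zp) : x * y = 0 -> (x == 0) || (y == 0).
Proof.
move=> xy0; apply/norP => -[/padic_neq0 [m [m0 m1]] /padic_neq0 [n [n0 n1]]].
have [_] := padic_val_mul_subproof m0 m1 n0 n1.
by rewrite xy0 /= mod0z eqxx.
Qed.

HB.instance Definition _ := GRing.ComUnitRing_isIntegral.Build Zp padic_integral.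

Lemma padic_valM (x y : Zp) : x != 0 -> y != 0 ->
  padic_val (x * y) = (padic_val x + padic_val y)%N.
Proof.
move=> x0 y0; apply/padic_valP; first by rewrite mulf_neq0.
have [x1 x2] := (padic_valP _ x0).1 erefl.
have [y1 y2] := (padic_valP _ y0).1 erefl.
exact: padic_val_mul_subproof.
Qed.

End PadicInt.

(* Q_p as the field of fractions of Z_p; Z_p embeds in it by x |-> x%:F. *)
Notation padic pp := {fraction (padic_int pp)}.
Notation "x %:F" := (FracField.tofrac x) : ring_scope.

Section PadicAbs.
Context (R : realType) (p : nat) (pp : prime p).

(* |n / d|_p = p ^ (v(d) - v(n)), computed on a chosen representative of the
   fraction; padic_abs_div shows that the choice is irrelevant. *)
Definition padic_abs (x : padic pp) : R :=
  if x == 0 then 0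
  else p%:R ^ ((padic_val \d_(repr x))%:Z - (padic_val \n_(repr x))%:Z).

Lemma padic_frac (x : padic pp) :
  x = (\n_(repr x))%:F / (\d_(repr x))%:F.
Proof.
have d0 : (\d_(repr x))%:F != 0 :> padic pp by rewrite tofrac_eq0 denom_ratioP.
apply: (mulIf d0); rewrite mulfVK // -[X in X * _](reprK x); unlock tofrac.
rewrite -[LHS]pi_mul; apply/eqmodP; rewrite /= /equivf /mulf.
by rewrite !numden_Ratio ?(oner_eq0, mulf_neq0) ?denom_ratioP // !mulr1 mulrC.
Qed.

Lemma padic_abs_div (a b : padic_int pp) : a != 0 -> b != 0 ->
  padic_abs (a%:F / b%:F) = p%:R ^ ((padic_val b)%:Z - (padic_val a)%:Z).
Proof.
move=> a0 b0; have F0 c : (c%:F == 0 :> padic pp) = (c == 0) := tofrac_eq0 c.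
have x0 : a%:F / b%:F != 0 :> padic pp by rewrite mulf_neq0 ?invr_eq0 ?F0.
rewrite /padic_abs (negPf x0); set x := a%:F / b%:F in x0 *.
have d0 : \d_(repr x) != 0 by exact: denom_ratioP.
have Ex := padic_frac x.
have n0 : \n_(repr x) != 0.
  by apply: contraNneq x0 => n0; rewrite Ex n0 tofrac0 mul0r.
have /eqP : a%:F / b%:F = (\n_(repr x))%:F / (\d_(repr x))%:F :> padic pp by [].
rewrite eqr_div ?F0 // -!tofracM tofrac_eq => /eqP /(congr1 (@padic_val _ _)).
rewrite !padic_valM // => /(congr1 Posz); rewrite !PoszD => E.
by congr (_ ^ _); apply/eqP; rewrite subr_eq addrAC eq_sym subr_eq addrC -E addrC.
Qed.

End PadicAbs.

Section Lattices.
Context (R : realType) (p : nat) (pp : prime p) (V : lmodType (padic pp)).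
Local Open Scope classical_set_scope.

Definition is_norm (N : V -> R) : Prop :=
  [/\ forall v, 0 <= N v /\ (N v = 0 <-> v = 0),
      forall (x : padic pp) v, N (x *: v) = padic_abs R x * N v &
      forall v w, N (v + w) <= Num.max (N v) (N w)].

Definition lin_indep m (v : m.-tuple V) : Prop :=
  forall a : 'I_m -> padic pp,
    \sum_(i < m) a i *: tnth v i = 0 -> forall i, a i = 0.

Definition lattice m (v : m.-tuple V) : set V :=
  [set w | exists a : 'I_m -> padic_int pp,
             w = \sum_(i < m) (a i)%:F *: tnth v i].

Definition linear_span (A : set V) : set V :=
  [set w | exists m (a : 'I_m -> padic pp) (u : 'I_m -> V),
             (forall i, A (u i)) /\ w = \sum_(i < m) a i *: u i].

Definition is_basis (U : set V) m (v : m.-tuple V) : Prop :=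
  lin_indep v /\ U = linear_span [set` v].

Definition orthogonal_basis (N : V -> R) (U : set V) m (v : m.-tuple V) : Prop :=
  is_basis U v /\
  forall a : 'I_m -> padic pp,
    N (\sum_(i < m) a i *: tnth v i) =
    \big[Num.max/0]_(i < m) N (a i *: tnth v i).

Definition lattice_orthogonal_basis (N : V -> R) (L : set V)
    m (v : m.-tuple V) : Prop :=
  L = lattice v /\ orthogonal_basis N (linear_span L) v.

End Lattices.

(* Programs are finite syntax, so that they cannot depend on the space, the norm
   or the input vectors except through the oracle call [Norm].  Scalars admit
   exact field arithmetic, reals only comparison. *)

Inductive scalar_expr : Type :=
| Reg of nat
| Cst of int
| Add of scalar_expr & scalar_expr
| Opp of scalar_expr
| Mul of scalar_expr & scalar_expr
| Inv of scalar_expr.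

Inductive test : Type :=
| RealLe of nat & nat
| ScalarEq of scalar_expr & scalar_expr
| Not of test
| And of test & test.

(* [Norm k e f] stores in the real register k the norm of the vector with
   coordinates (e, f) with respect to the input vectors. *)
Inductive instr : Type :=
| Assign of nat & scalar_expr
| Norm of nat & scalar_expr & scalar_expr
| If of test & seq instr & seq instr
| While of test & seq instr.

Definition program := seq instr.

Definition update (T : Type) (f : nat -> T) (k : nat) (x : T) : nat -> T :=
  fun j => if j == k then x else f j.

Section Semantics.
Context (R : realType) (p : nat) (pp : prime p) (V : lmodType (padic pp)).
Context (N : V -> R) (alpha beta : V).

Record state := State {
  scalars : nat -> padic pp;
  reals : nat -> R
}.

(* As in any MathComp field, the inverse of 0 is 0. *)
Fixpoint eval (s : state) (e : scalar_expr) : padic pp :=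
  match e with
  | Reg k => scalars s k
  | Cst c => c%:~R
  | Add e f => eval s e + eval s f
  | Opp e => - eval s e
  | Mul e f => eval s e * eval s f
  | Inv e => (eval s e)^-1
  end.

Fixpoint holds (s : state) (t : test) : bool :=
  match t with
  | RealLe j k => reals s j <= reals s k
  | ScalarEq e f => eval s e == eval s f
  | Not t => ~~ holds s t
  | And t u => holds s t && holds s u
  end.

Definition vector (s : state) (e f : scalar_expr) : V :=
  eval s e *: alpha + eval s f *: beta.

(* A configuration is the list of instructions still to be executed together
   with the current state; the machine has halted when this list is empty. *)
Definition step (c : program * state) : program * state :=
  let: (prog, s) := c in
  match prog with
  | [::] => c
  | Assign k e :: rest =>
      (rest, State (update (scalars s) k (eval s e)) (reals s))
  | Norm k e f :: rest =>
      (rest, State (scalars s) (update (reals s) k (N (vector s e f))))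
  | If t prog1 prog2 :: rest =>
      ((if holds s t then prog1 else prog2) ++ rest, s)
  | While t body :: rest =>
      (if holds s t then body ++ prog else rest, s)
  end.

Definition initial_state : state := State (fun=> 0) (fun=> 0).

Definition halts_in (prog : program) (s : state) : Prop :=
  exists n, iter n step (prog, initial_state) = ([::], s).

(* The output is read in the registers 0, 1 (coordinates of the first vector)
   and 2, 3 (coordinates of the second one). *)
Definition output (s : state) : 2.-tuple V :=
  [tuple vector s (Reg 0) (Reg 1); vector s (Reg 2) (Reg 3)].

End Semantics.

(* Main.v *)
(* Let N x <= N y for the given basis, in some order. If N x <= N (x + b y) for
   all b in Q_p, then x, y is N-orthogonal, so it suffices to minimise N on the
   line x + Q_p y by replacing x with some x + m y, m an integer, which keeps the
   lattice. Suppose N x <= N (p^k y), and replace x by a vector of least norm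
   among the x + c p^k y with 0 <= c <= p. If then N (p^(k+1) y) < N x, adding
   elements of p^(k+1) Z_p y does not change the norm, and x is minimal; otherwise
   N x <= N (p^(k+1) y) and one goes on with k + 1. This cannot go on for ever:
   the multiples of y would converge in Z_p, giving x + m y = 0. *)

Require Import Defs.
From mathcomp Require Import all_boot all_order all_algebra.
From mathcomp Require Import reals.
From mathcomp Require Import fraction boolp classical_sets.
From mathcomp Require Import ring.

Set Implicit Arguments.
Unset Strict Implicit.
Unset Printing Implicit Defensive.

Import Order.TTheory GRing.Theory Num.Theory.
Local Open Scope ring_scope.

(** * Absolute values and leading digits of p-adic numbers *)

Section PadicAbs.
Context (R : realType) (p : nat) (pp : prime p).
Local Notation Zp := (padic_int pp).
Local Notation Qp := (padic pp).
Local Notation q n := ((p ^ n)%N : int).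
Local Notation abs := (@padic_abs R p pp).

Let p_gt0 : 0 < p%:R :> R. Proof. by rewrite ltr0n prime_gt0. Qed.
Let p_gt1 : 1 < p%:R :> R. Proof. by rewrite ltr1n prime_gt1. Qed.

Lemma residue_int (m : int) n : residue (m%:~R : Zp) n = (m %% q n)%Z.
Proof.
have nat_case k : residue (k%:R : Zp) n = (k%:Z %% q n)%Z.
  elim: k => [|k IHk]; first by [].
  by rewrite -addn1 natrD PoszD /= IHk modzDml modzDmr.
case: m => k; first by rewrite -pmulrn nat_case.
by rewrite NegzE mulrNz -pmulrn /= nat_case modzNm.
Qed.

Lemma padic_val_ge (x : Zp) n :
  x != 0 -> (n <= padic_val x)%N = (residue x n == 0).
Proof.
move=> x0; have [r0 r1] := (padic_valP _ x0).1 erefl.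
case: leqP => [le|lt]; first by rewrite -(residue_dvd _ le) r0 dvdz0.
apply/esym/negbTE; apply: contra r1 => /eqP rn.
by rewrite -(residue_dvd _ lt) rn dvdz0.
Qed.

Lemma padic_abs0 : abs 0 = 0. Proof. by rewrite /padic_abs eqxx. Qed.

Lemma padic_abs_val (x : Zp) : x != 0 -> abs x%:F = p%:R ^- padic_val x.
Proof.
move=> x0; have v1 : padic_val (1 : Zp) = 0%N.
  have := @padic_valM _ pp 1 1 (oner_neq0 _) (oner_neq0 _).
  rewrite mul1r; case: padic_val => // n /eqP.
  by rewrite -[X in X == _]addn0 eqn_add2l.
rewrite -[x%:F]divr1 -tofrac1 padic_abs_div ?oner_neq0 // v1 sub0r.
by rewrite exprnN.
Qed.

(** Translates between sizes and congruences, so that norm estimates on multiples of a vector can be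
    settled by arithmetic on integer residues. *)
Lemma padic_abs_int_le (x : Zp) n :
  (abs x%:F <= p%:R ^- n) = (residue x n == 0).
Proof.
have [->|x0] := eqVneq x 0.
  by rewrite tofrac0 padic_abs0 invr_ge0 exprn_ge0 ?ltW //= mod0z eqxx.
rewrite padic_abs_val // lef_pV2 ?posrE ?exprn_gt0 //.
by rewrite ler_eXn2l // padic_val_ge.
Qed.

Lemma padic_abs_ge0 (x : Qp) : 0 <= abs x.
Proof. by rewrite /padic_abs; case: ifP => // _; rewrite exprz_ge0 ?ltW. Qed.

Lemma padic_absM (x y : Qp) : abs (x * y) = abs x * abs y.
Proof.
have [->|x0] := eqVneq x 0; first by rewrite mul0r padic_abs0 mul0r.
have [->|y0] := eqVneq y 0; first by rewrite mulr0 padic_abs0 mulr0.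
move: x0 y0; rewrite (padic_frac x) (padic_frac y).
have := denom_ratioP (repr x); have := denom_ratioP (repr y).
move: (\d_(repr x)) (\d_(repr y)) (\n_(repr x)) (\n_(repr y)) => b d a c d0 b0.
rewrite !mulf_eq0 !negb_or !tofrac_eq0 => /andP[a0 _] /andP[c0 _].
rewrite mulf_div -!tofracM !padic_abs_div ?mulf_neq0 // !padic_valM //.
by rewrite -expfzDr ?gt_eqF // !PoszD; congr (_ ^ _); ring.
Qed.

Lemma padic_abs1 : abs 1 = 1.
Proof.
have : abs 1 * abs 1 = abs 1 by rewrite -padic_absM mulr1.
have : abs 1 != 0 by rewrite /padic_abs oner_eq0 expfz_neq0 // gt_eqF.
by move=> n0 /(canRL (mulfK n0)) ->; rewrite divff.
Qed.

Lemma padic_absN (x : Qp) : abs (- x) = abs x.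
Proof.
(* It suffices that [abs (-1)] is 1: it is nonnegative and its square is [abs 1]. *)
rewrite -mulN1r padic_absM -[RHS]mul1r; congr (_ * _); apply/eqP.
rewrite -(@eqrXn2 _ 2) ?padic_abs_ge0 // expr1n expr2 -padic_absM mulrNN mulr1.
by rewrite padic_abs1.
Qed.

Lemma padic_absX n : abs (p%:R ^+ n) = p%:R ^- n.
Proof.
elim: n => [|n IHn]; first by rewrite !expr0 padic_abs1 invr1.
rewrite exprS padic_absM IHn exprS invfM; congr (_ * _).
have [p_dvd p_ndvd] : residue (p%:R : Zp) 1 = 0 /\ residue (p%:R : Zp) 2 != 0.
  rewrite -[p%:R]/(p%:Z%:~R) !residue_int expn1 modzz; split=> //.
  rewrite modz_small; first by rewrite -lt0n prime_gt0.
  by rewrite lez_nat ltz_nat -[X in (X < _)%N]expn1 ltn_exp2l ?prime_gt1.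
have p0 : (p%:R : Zp) != 0 by apply: contraNneq p_ndvd => ->; rewrite /= mod0z.
rewrite -(rmorph_nat (@FracField.tofrac Zp)) padic_abs_val // -[RHS]expr1.
have -> : padic_val (p%:R : Zp) = 1%N by exact/padic_valP.
by rewrite !expr1.
Qed.

(** Let b = a/d and let v be the valuation of d; the bound on b makes p^v divide a. The residues of
    a and d modulo p^(v+1) are then A p^v and D p^v with D prime to p, and the digit is A/D modulo
    p. *)
Lemma padic_digit (b : Qp) : abs b <= 1 ->
  exists2 c, (c < p)%N & abs (b - c%:R) <= p%:R^-1.
Proof.
have [->|b0] := eqVneq b 0.
  exists 0%N; first exact: prime_gt0.
  by rewrite subr0 padic_abs0 invr_ge0 ltW.
move: b0; rewrite (padic_frac b).
have := denom_ratioP (repr b).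
move: (\d_(repr b)) (\n_(repr b)) => d a d0.
rewrite !mulf_eq0 !negb_or !tofrac_eq0 => /andP[a0 _].
rewrite padic_abs_div //; set v := padic_val d => vle.
have {}vle : (v <= padic_val a)%N.
  rewrite leqNgt; apply/negP => lt; move: vle; apply/negP; rewrite -ltNge.
  by rewrite subzn 1?ltnW // exprn_egt1 ?subn_eq0 -?ltnNge.
have [_ dv1] := (padic_valP v d0).1 erefl.
have dv : (q v %| residue d v.+1)%Z.
  by rewrite residue_dvd // -padic_val_ge.
have av : (q v %| residue a v.+1)%Z by rewrite residue_dvd // -padic_val_ge.
have /dvdzP[A EA] := av; have /dvdzP[D ED] := dv.
have qS : q v.+1 = p%:Z * q v by rewrite expnS PoszM.
have qv0 : q v != 0 :> int by rewrite -lt0n expn_gt0 prime_gt0.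
have pD : coprimez p D.
  rewrite /coprimez /gcdz /= -[_ == _]/(coprime p `|D|) prime_coprime //.
  apply: contra dv1 => pD; rewrite -residue_mod ED; apply/eqP/dvdz_mod0P.
  by rewrite qS dvdz_mul2r.
(* By Bezout, [w] is an inverse of [D] modulo p. *)
have [[u w] /= uw] := coprimezP _ _ pD.
have p0 : p%:Z != 0 by rewrite -lt0n prime_gt0.
pose c := ((A * w) %% p)%Z.
have [n En] : exists n : nat, c = n.
  by exists `|c|%N; rewrite gez0_abs // modz_ge0.
have np : (n < p)%N by rewrite -ltz_nat -En ltz_pmod // ltz_nat prime_gt0.
exists n => //.
have -> : a%:F / d%:F - n%:R = (a - n%:R * d)%:F / d%:F.
  by rewrite tofracB tofracM rmorph_nat mulrBl mulfK ?tofrac_eq0.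
have d_gt0 : 0 < abs d%:F by rewrite padic_abs_val // invr_gt0 exprn_gt0.
(* Multiplying by [abs d%:F], which is p^-v, turns the bound 1/p into p^-(v+1). *)
suff : abs (a - n%:R * d)%:F <= p%:R ^- v.+1.
  move=> le; rewrite -(ler_pM2r d_gt0).
  rewrite -padic_absM mulfVK ?tofrac_eq0 // (padic_abs_val d0).
  by apply: le_trans le _; rewrite exprS invfM.
rewrite padic_abs_int_le /= -[n%:R]/(n%:Z%:~R) residue_int.
rewrite modzMml modzNm modzDmr.
apply/eqP/dvdz_mod0P; rewrite -En EA ED mulrA -mulrBl qS dvdz_mul2r //.
have -> : A - c * D = (u * A + (A * w %/ p)%Z * D) * p.
  rewrite /c /modz.
  transitivity (A * (u * p + w * D) - (A * w - (A * w %/ p)%Z * p) * D).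
    by rewrite uw mulr1.
  by ring.
exact: dvdz_mull.
Qed.

End PadicAbs.

(** * Lattices of rank two and their changes of basis *)

Section Lattice.
Context (p : nat) (pp : prime p) (V : lmodType (padic pp)).
Local Open Scope classical_set_scope.

Lemma lattice2E (x y : V) : lattice [tuple x; y] =
  [set w | exists a b : padic_int pp, w = a%:F *: x + b%:F *: y].
Proof.
apply/seteqP; split=> w /=.
  move=> [a ->]; exists (a ord0), (a (lift ord0 ord0)).
  by rewrite !big_ord_recl big_ord0 addr0 !(tnth_nth 0).
move=> [a [b ->]]; exists (fun i : 'I_2 => if val i == 0%N then a else b).
by rewrite !big_ord_recl big_ord0 addr0 !(tnth_nth 0).
Qed.

Lemma lattice2C (x y : V) : lattice [tuple x; y] = lattice [tuple y; x].
Proof.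
rewrite !lattice2E; apply/seteqP.
by split=> w [a [b ->]]; exists b, a; rewrite addrC.
Qed.

(** Integers lie in Z_p, so the shear acts invertibly on Z_p-coefficients; hence x may move by
    integer multiples of y. *)
Lemma lattice2_shear (x y : V) (m : int) :
  lattice [tuple x + m%:~R *: y; y] = lattice [tuple x; y].
Proof.
rewrite !lattice2E; apply/seteqP; split=> w [a [b ->]].
  exists a, (a * m%:~R + b).
  by rewrite tofracD tofracM rmorph_int scalerDl -scalerA scalerDr addrA.
exists a, (b - a * m%:~R).
rewrite tofracB tofracM rmorph_int scalerDr scalerBl scalerA.
by rewrite -addrA subrKC.
Qed.

Lemma lin_indep2P (x y : V) : lin_indep [tuple x; y] <->
  forall a b, a *: x + b *: y = 0 -> a = 0 /\ b = 0.
Proof.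
split=> [ind a b ab0|ind a].
  have E := ind (fun i : 'I_2 => if val i == 0%N then a else b).
  split; [apply: (E _ ord0)|apply: (E _ (lift ord0 ord0))];
    by rewrite !big_ord_recl big_ord0 /= addr0 !(tnth_nth 0).
rewrite !big_ord_recl big_ord0 addr0 !(tnth_nth 0) /= => /ind[a0 a1] i.
by case: i => -[|[|//]] lt; [rewrite -a0|rewrite -a1]; congr a; apply: val_inj.
Qed.

Lemma lin_indep2C (x y : V) : lin_indep [tuple x; y] -> lin_indep [tuple y; x].
Proof.
by move=> /lin_indep2P ind; apply/lin_indep2P => a b; rewrite addrC => /ind[].
Qed.

Lemma lin_indep2_shear (x y : V) c :
  lin_indep [tuple x; y] -> lin_indep [tuple x + c *: y; y].
Proof.
move=> /lin_indep2P ind; apply/lin_indep2P => a b.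
rewrite scalerDr scalerA -addrA -scalerDl => /ind[a0].
by rewrite a0 mul0r add0r.
Qed.

(** Kronecker coefficients put each [tnth v j] in the lattice; conversely, a combination of lattice
    vectors regroups along [v]. *)
Lemma linear_span_lattice m (v : m.-tuple V) :
  linear_span (lattice v) = linear_span [set` v].
Proof.
apply/seteqP; split=> w [n [a [u [uv ->]]]]; last first.
  exists n, a, u; split=> // i.
  have /tnthP[j ->] := uv i.
  exists (fun l => (l == j)%:R).
  rewrite (bigD1 j) //= eqxx tofrac1 scale1r big1 ?addr0 //.
  by move=> l /negPf ->; rewrite tofrac0 scale0r.
have /choice[b Eb] := uv.
exists m, (fun j => \sum_(i < n) a i * (b i j)%:F), (tnth v); split=> [i|].
  exact: mem_tnth.
under eq_bigr do rewrite Eb scaler_sumr.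
rewrite exchange_big /=; apply: eq_bigr => j _; rewrite scaler_suml.
by apply: eq_bigr => i _; rewrite scalerA.
Qed.

End Lattice.

(** * Ultrametric estimates, minimality on a line and orthogonality *)

Section Norm.
Context (R : realType) (p : nat) (pp : prime p) (V : lmodType (padic pp)).
Context (N : V -> R) (normN : is_norm N).
Local Notation Zp := (padic_int pp).
Local Notation Qp := (padic pp).
Local Notation q n := ((p ^ n)%N : int).
Local Notation abs := (@padic_abs R p pp).

Let p_gt0 : 0 < p%:R :> R. Proof. by rewrite ltr0n prime_gt0. Qed.
Let p_gt1 : 1 < p%:R :> R. Proof. by rewrite ltr1n prime_gt1. Qed.

Lemma norm_ge0 v : 0 <= N v. Proof. by case: normN => + _ _ => /(_ v)[]. Qed.

Lemma norm_eq0 v : N v = 0 -> v = 0.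
Proof. by case: normN => + _ _ => /(_ v)[_ []]. Qed.

Lemma normZ (a : Qp) v : N (a *: v) = abs a * N v.
Proof. by case: normN. Qed.

Lemma norm0 : N 0 = 0. Proof. by case: normN => /(_ 0)[_ [_]] ->. Qed.

Lemma normD v w : N (v + w) <= Num.max (N v) (N w).
Proof. by case: normN. Qed.

Lemma norm_opp v : N (- v) = N v.
Proof. by rewrite -scaleN1r normZ padic_absN padic_abs1 mul1r. Qed.

Lemma normD_le v w r : N v <= r -> N w <= r -> N (v + w) <= r.
Proof. by move=> vr wr; rewrite (le_trans (normD v w)) // ge_max vr. Qed.

(** Writing v as (v + w) - w bounds N v by the larger of N (v + w) and N w, and N w is too small. *)
Lemma normD_lt v w : N w < N v -> N (v + w) = N v.
Proof.
move=> wv; apply/eqP; rewrite eq_le normD_le ?(ltW wv) //=.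
have := normD (v + w) (- w); rewrite addrK norm_opp le_max.
by rewrite (leNgt (N v) (N w)) wv orbF.
Qed.

Lemma normXp k v : N (p%:R ^+ k *: v) = p%:R ^- k * N v.
Proof. by rewrite normZ padic_absX. Qed.

Lemma normXp_le k l v :
  (k <= l)%N -> N (p%:R ^+ l *: v) <= N (p%:R ^+ k *: v).
Proof.
move=> kl; rewrite !normXp ler_wpM2r ?norm_ge0 // lef_pV2 ?posrE ?exprn_gt0 //.
by rewrite ler_weXn2l // ltW.
Qed.

(* Otherwise integers m_k with N (x + m_k y) <= N (p^k y) would converge, Z_p
   being complete, to some m with x + m y = 0. *)
Lemma dist_line_gt0 (x y : V) : lin_indep [tuple x; y] ->
  exists k, forall m : int, N (p%:R ^+ k *: y) < N (x + m%:~R *: y).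
Proof.
move=> /lin_indep2P ind; apply: contrapT => noK.
have {noK} /choice[m Nm] : forall k,
    exists m : int, N (x + m%:~R *: y) <= N (p%:R ^+ k *: y).
  move=> k; apply: contrapT => nom; apply: noK; exists k => m.
  by rewrite ltNge; apply/negP => le; apply: nom; exists m.
have Ny : 0 < N y.
  rewrite lt_def norm_ge0 andbT; apply/eqP => /norm_eq0 y0.
  have [//|_ /eqP] := ind 0 1; first by rewrite y0 !scale0r scaler0 addr0.
  by rewrite oner_eq0.
have scale_le (z : Zp) k :
    (N (z%:F *: y) <= N (p%:R ^+ k *: y)) = (residue z k == 0).
  by rewrite normXp normZ ler_pM2r // padic_abs_int_le.
(* (m_(n+1) - m_n) y is a difference of two vectors of norm at most N (p^n y). *)
have m_cvg n : (m n.+1 = m n %[mod q n])%Z.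
  apply/eqP; rewrite eqz_mod_dvd; apply/dvdz_mod0P/eqP.
  rewrite -(residue_int pp) -scale_le rmorph_int.
  rewrite rmorphB /= scalerBl.
  have -> : (m n.+1)%:~R *: y - (m n)%:~R *: y =
            (x + (m n.+1)%:~R *: y) - (x + (m n)%:~R *: y).
    by rewrite opprD addrACA subrr add0r.
  by apply: normD_le; rewrite ?norm_opp // (le_trans (Nm _)) // normXp_le.
pose mu : Zp := padic_limit pp m_cvg.
have mu_le k : N (x + mu%:F *: y) <= N (p%:R ^+ k *: y).
  have -> : x + mu%:F *: y = (x + (m k)%:~R *: y) + (mu - (m k)%:~R)%:F *: y.
    by rewrite tofracB rmorph_int scalerBl -addrA subrKC.
  apply: normD_le => //; rewrite scale_le.
  by rewrite [residue _ _]/= residue_int modzNm modzDm subrr mod0z.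
have [|/eqP] := ind 1 mu%:F; last by rewrite oner_eq0.
rewrite scale1r; apply: norm_eq0; apply/eqP; rewrite eq_le norm_ge0 andbT.
rewrite leNgt; apply/negP => dpos.
(* The integer k above N y / N (x + mu y) is also below p^k, which contradicts [mu_le] at k. *)
have := truncnS_gt (N y / N (x + mu%:F *: y)).
set k := (Num.truncn _).+1 => k_gt.
have : N (x + mu%:F *: y) <= p%:R ^- k * N y by rewrite -normXp.
apply/negP; rewrite -ltNge mulrC ltr_pdivrMr ?exprn_gt0 //.
rewrite mulrC -ltr_pdivrMr //.
by apply: lt_trans k_gt _; rewrite -natrX ltr_nat ltn_expl ?prime_gt1.
Qed.

(* With z = p^k y and b = b' p^k: if |b'| > 1, then b y dominates x; otherwise
   b' may be replaced by its digit modulo p, at the cost of a vector of norm at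
   most N (p z). *)
Lemma norm_min_line (x y : V) k r :
  N x <= N (p%:R ^+ k *: y) -> N (p%:R ^+ k.+1 *: y) < r ->
  (forall c, (c < p)%N -> r <= N (x + (c%:R * p%:R ^+ k) *: y)) ->
  forall b, r <= N (x + b *: y).
Proof.
move=> x_le r_gt r_min b; set z := p%:R ^+ k *: y.
have r_le : r <= N x.
  by have := r_min 0%N (prime_gt0 pp); rewrite mul0r scale0r addr0.
have pk0 : p%:R ^+ k != 0 :> Qp.
  apply/eqP => pk0; have := padic_absX R pp k.
  by move=> /esym/eqP; rewrite pk0 padic_abs0 invr_eq0 expf_eq0 gt_eqF ?andbF.
have Eb : b *: y = (b / p%:R ^+ k) *: z by rewrite scalerA divfK.
rewrite Eb; set b' := b / _.
have [b1|b1] := leP (abs b') 1; last first.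
  have [z0|z0] := eqVneq (N z) 0.
    by rewrite (norm_eq0 z0) scaler0 addr0.
  have lt : N z < N (b' *: z).
    by rewrite [X in _ < X]normZ ltr_pMl // lt_def z0 norm_ge0.
  rewrite addrC normD_lt ?(le_lt_trans x_le) //.
  by rewrite (le_trans r_le) // (le_trans x_le) // ltW.
have [c cp bc] := padic_digit b1.
have -> : x + b' *: z = (x + (c%:R * p%:R ^+ k) *: y) + (b' - c%:R) *: z.
  by rewrite -scalerA -/z scalerBl -addrA subrKC.
have le : N ((b' - c%:R) *: z) < r.
  apply: le_lt_trans r_gt; rewrite exprS -scalerA -/z.
  rewrite (normZ _ z) (normZ _ z) ler_wpM2r ?norm_ge0 //.
  by have -> : abs p%:R = p%:R^-1 := padic_absX R pp 1.
by rewrite normD_lt ?r_min // (lt_le_trans le) // r_min.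
Qed.

(** Dividing by a nonzero [a] reduces to a = 1. There minimality bounds N x by N (x + b y), and b y
    = (x + b y) - x then obeys the same bound. *)
Lemma orthogonal_pair (x y : V) : (forall b, N x <= N (x + b *: y)) ->
  forall a b, N (a *: x + b *: y) = Num.max (N (a *: x)) (N (b *: y)).
Proof.
move=> x_min a b; have [->|a0] := eqVneq a 0.
  by rewrite scale0r norm0 add0r (max_idPr (norm_ge0 _)).
have -> : b *: y = a *: ((b / a) *: y) by rewrite scalerA mulrCA mulfV ?mulr1.
rewrite -scalerDr !normZ -maxr_pMr ?padic_abs_ge0 //.
congr (_ * _); rewrite -normZ.
apply/eqP; rewrite eq_le normD ge_max x_min /=.
rewrite -[X in N X <= _](addKr x) addrC.
apply: normD_le => //; by rewrite norm_opp x_min.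
Qed.

Lemma lattice2_orthogonal (x y : V) :
  lin_indep [tuple x; y] -> (forall b, N x <= N (x + b *: y)) ->
  lattice_orthogonal_basis N (lattice [tuple x; y]) [tuple x; y].
Proof.
move=> ind x_min; split=> //; split.
  by split=> //; exact: linear_span_lattice.
move=> a; rewrite !big_ord_recl !big_ord0 addr0 !(tnth_nth 0) /=.
(* The iterated maximum starts from 0, which is absorbed because norms are nonnegative. *)
by rewrite (max_idPl (norm_ge0 _)) orthogonal_pair.
Qed.

End Norm.

(** * Proof rules for the total correctness of programs *)

Section Triples.
Context (R : realType) (p : nat) (pp : prime p) (V : lmodType (padic pp)).
Context (N : V -> R) (alpha beta : V).
Local Notation state := (state R pp).
Local Notation step := (step N alpha beta).
Local Notation vector := (vector alpha beta).
Implicit Types (s : state) (P Q : state -> Prop).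

(** Total correctness with postcondition [Q]; quantifying over the continuation [rest] lets
    specifications compose under concatenation. *)
Definition reaches (prog : program) s Q : Prop := forall rest,
  exists n s', iter n step (prog ++ rest, s) = (rest, s') /\ Q s'.

Lemma reaches_nil s Q : Q s -> reaches [::] s Q.
Proof. by move=> Qs rest; exists 0%N, s. Qed.

Lemma reaches_step i prog prog' s s' Q :
  (forall rest, step (i :: prog ++ rest, s) = (prog' ++ rest, s')) ->
  reaches prog' s' Q -> reaches (i :: prog) s Q.
Proof.
move=> one H rest; have [n [t [En Qt]]] := H rest.
by exists n.+1, t; rewrite iterSr cat_cons one.
Qed.

Lemma reaches_cat prog1 prog2 s P Q : reaches prog1 s P ->
  (forall t, P t -> reaches prog2 t Q) -> reaches (prog1 ++ prog2) s Q.
Proof.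
move=> H1 H2 rest; have [n [t [En Pt]]] := H1 (prog2 ++ rest).
have [m [u [Em Qu]]] := H2 t Pt rest.
by exists (m + n)%N, u; rewrite iterD -catA En.
Qed.

Lemma reaches_weaken prog s P Q :
  reaches prog s P -> (forall t, P t -> Q t) -> reaches prog s Q.
Proof.
by move=> H PQ rest; have [n [t [En /PQ Qt]]] := H rest; exists n, t.
Qed.

Lemma reaches_assign k e prog s Q :
  reaches prog (State (update (scalars s) k (eval s e)) (reals s)) Q ->
  reaches (Assign k e :: prog) s Q.
Proof. exact: reaches_step. Qed.

Lemma reaches_norm k e f prog s Q :
  reaches prog (State (scalars s) (update (reals s) k (N (vector s e f)))) Q ->
  reaches (Norm k e f :: prog) s Q.
Proof. exact: reaches_step. Qed.

Lemma reaches_if t prog1 prog2 prog s Q :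
  reaches ((if holds s t then prog1 else prog2) ++ prog) s Q ->
  reaches (If t prog1 prog2 :: prog) s Q.
Proof. by apply: reaches_step => rest; rewrite /= catA. Qed.

(** The invariant [J] is indexed by the number of completed rounds. A true test forces k < K, so the
    loop ends, by induction on a fuel at least K - k. *)
Lemma reaches_while t body s Q (J : nat -> state -> Prop) K :
  (forall k s, J k s -> holds s t -> (k < K)%N /\ reaches body s (J k.+1)) ->
  (forall k s, J k s -> ~~ holds s t -> Q s) ->
  J 0%N s -> reaches [:: While t body] s Q.
Proof.
move=> iter_J exit_J; have : (K - 0 <= K)%N by rewrite subn0.
have stop k u : J k u -> ~~ holds u t -> reaches [:: While t body] u Q.
  move=> Ju nut; apply: (@reaches_step _ _ [::] _ u) => [rest|].
    by rewrite /= (negPf nut).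
  by apply: reaches_nil; apply: exit_J Ju nut.
move: {2}K 0%N s => n; elim: n => [|n IHn] k s kn Jk;
  have [st|] := boolP (holds s t); try exact: stop Jk.
  (* Zero fuel means K <= k, which a true test excludes. *)
  have [kK _] := iter_J k s Jk st.
  by move: kn; rewrite leqn0 subn_eq0 leqNgt kK.
have [kK body_J] := iter_J k s Jk st.
apply: (@reaches_step _ _ (body ++ [:: While t body]) _ s) => [rest|].
  by rewrite /= st -catA.
apply: reaches_cat body_J _ => u Ju; apply: (IHn k.+1) => //.
by rewrite subnS -ltnS prednK ?subn_gt0.
Qed.

Lemma reaches_halts prog Q : reaches prog (initial_state R pp) Q ->
  exists2 s, halts_in N alpha beta prog s & Q s.
Proof.
move=> /(_ [::]) [n [s []]]; rewrite cats0 => En Qs.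
by exists s => //; exists n.
Qed.

End Triples.

(** * The algorithm as a program *)

(** A vector of smaller norm becomes x, the other y; scalar registers start at 0, so only the
    coordinates equal to 1 are set. Norms go to real registers 3 and 4, which leaves 0 and 2,
    compared by the loop, at 0. *)
Definition choose_basis : program :=
  [:: Norm 3 (Cst 1) (Cst 0); Norm 4 (Cst 0) (Cst 1);
      If (RealLe 3 4) [:: Assign 0 (Cst 1); Assign 3 (Cst 1)]
                      [:: Assign 1 (Cst 1); Assign 2 (Cst 1)];
      Assign 4 (Cst 1)].

(* Registers: (0, 1) the current x, (2, 3) the fixed vector y, 4 the power of p,
   (5, 6) the candidate x0 + c p^k y; real register 0 holds N x. *)
Definition try_next : program :=
  [:: Assign 5 (Add (Reg 5) (Mul (Reg 4) (Reg 2)));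
      Assign 6 (Add (Reg 6) (Mul (Reg 4) (Reg 3)));
      Norm 1 (Reg 5) (Reg 6);
      If (RealLe 0 1) [::]
        [:: Assign 0 (Reg 5); Assign 1 (Reg 6); Norm 0 (Reg 0) (Reg 1)]].

(** The scan is unrolled: [n] is known when the program is built, so no counter register is
    needed. *)
Fixpoint try_all (n : nat) : program :=
  if n is n'.+1 then try_all n' ++ try_next else [::].

(** One round at level k. The initial copy accounts for c = 0 and [try_all] for c from 1 to p; real
    register 2 then holds N (p^(k+1) y) for the loop test. *)
Definition reduce (p : nat) : program :=
  [:: Assign 5 (Reg 0); Assign 6 (Reg 1); Norm 0 (Reg 0) (Reg 1)] ++
  try_all p ++
  [:: Assign 4 (Mul (Cst p) (Reg 4));
      Norm 2 (Mul (Reg 4) (Reg 2)) (Mul (Reg 4) (Reg 3))].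

(* Real registers are initially 0, so the loop is entered. *)
Definition orthogonalize (p : nat) : program :=
  choose_basis ++ [:: While (RealLe 0 2) (reduce p)].

(** * Effect of one round on the registers *)

Section Correctness.
Context (R : realType) (p : nat) (pp : prime p) (V : lmodType (padic pp)).
Context (N : V -> R) (alpha beta : V).
Local Notation state := (state R pp).
Local Notation reaches := (reaches N alpha beta).

Definition vec_x (s : state) := vector alpha beta s (Reg 0) (Reg 1).
Definition vec_y (s : state) := vector alpha beta s (Reg 2) (Reg 3).
Definition vec_z (s : state) := vector alpha beta s (Reg 5) (Reg 6).

(** Induction on the number of candidates. [x] names the starting vector, since registers 0 and 1
    may be overwritten while the candidates stay relative to it. *)
Lemma try_all_correct n s x y k :
  vec_x s = x -> vec_y s = y -> vec_z s = x -> scalars s 4 = p%:R ^+ k ->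
  reals s 0 = N x ->
  reaches (try_all n) s (fun t =>
    [/\ exists c : nat, vec_x t = x + (c%:R * p%:R ^+ k) *: y,
        forall c, (c <= n)%N -> N (vec_x t) <= N (x + (c%:R * p%:R ^+ k) *: y),
        vec_z t = x + (n%:R * p%:R ^+ k) *: y &
        [/\ vec_y t = y, scalars t 4 = p%:R ^+ k & reals t 0 = N (vec_x t)]]).
Proof.
move=> sx sy sz s4 s0; elim: n => [|n IHn].
  apply: reaches_nil; split; rewrite ?mul0r ?scale0r ?addr0 ?sx //.
    by exists 0%N; rewrite mul0r scale0r addr0.
  by move=> c; rewrite leqn0 => /eqP ->; rewrite mul0r scale0r addr0.
rewrite /=; apply: reaches_cat IHn _ => {sx sy sz s4 s0} t.
move=> [tx tmin tz [ty t4 t0]].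
do 2 apply: reaches_assign; apply: reaches_norm.
set u := State _ _.
have ux : vec_x u = vec_x t by [].
have uy : vec_y u = y by [].
have u4 : scalars u 4 = p%:R ^+ k by [].
have uz : vec_z u = x + (n.+1%:R * p%:R ^+ k) *: y.
  rewrite -addn1 natrD mulrDl mul1r scalerDl addrA -tz -ty -t4.
  rewrite /vec_z /vec_y /vector /= /update /=.
  by rewrite !scalerDl !scalerDr !scalerA addrACA.
have u0 : reals u 0 = N (vec_x u) by [].
have u1 : reals u 1 = N (vec_z u) by [].
clearbody u; apply: reaches_if; rewrite cats0 /=.
case: ifP; rewrite u0 u1 => cmp.
  apply: reaches_nil; split=> //; first by rewrite ux.
  by move=> c; rewrite leq_eqVlt => /predU1P[->|/tmin]; rewrite ?ux // -ux -uz.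
(* The candidate is shorter than the best vector so far, hence by transitivity no longer than any
   earlier candidate. *)
move: cmp => /negbT; rewrite -ltNge => /ltW cmp.
do 2 apply: reaches_assign; apply: reaches_norm; apply: reaches_nil.
set w := State _ _.
have wx : vec_x w = vec_z u by [].
split=> //; first by exists n.+1; rewrite wx.
move=> c; rewrite wx leq_eqVlt => /predU1P[->|/tmin]; first by rewrite uz.
by apply: le_trans; rewrite -ux.
Qed.

Lemma reduce_correct s k : scalars s 4 = p%:R ^+ k ->
  reaches (reduce p) s (fun t =>
    [/\ exists c : nat, vec_x t = vec_x s + (c%:R * p%:R ^+ k) *: vec_y s,
        forall c, (c <= p)%N ->
          N (vec_x t) <= N (vec_x s + (c%:R * p%:R ^+ k) *: vec_y s),
        vec_y t = vec_y s &
        [/\ scalars t 4 = p%:R ^+ k.+1, reals t 0 = N (vec_x t) &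
            reals t 2 = N (p%:R ^+ k.+1 *: vec_y s)]]).
Proof.
move=> s4; rewrite /reduce.
do 2 apply: reaches_assign; apply: reaches_norm.
apply: reaches_cat.
  by apply: (@try_all_correct p _ (vec_x s) (vec_y s) k).
move=> t [tx tmin _ [ty t4 t0]]; apply: reaches_assign; apply: reaches_norm.
apply: reaches_nil; split=> //; split=> //=.
  by rewrite /update /= t4 exprS.
rewrite /update /= /vector /= -ty /update /= t4 -exprS scalerDr !scalerA.
by rewrite pmulrn.
Qed.

End Correctness.

(** * Loop invariant and bound on the number of rounds *)

Theorem theorem5p8 (R : realType) (p : nat) (pp : prime p) :
  exists prog : program,
    forall (V : lmodType (padic pp)) (N : V -> R), is_norm N ->
    forall alpha beta : V, lin_indep [tuple alpha; beta] ->
    exists2 s : state R pp, halts_in N alpha beta prog s &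
      lattice_orthogonal_basis N (lattice [tuple alpha; beta])
        (output alpha beta s).
Proof.
exists (orthogonalize p) => V N normN alpha beta ind; apply: reaches_halts.
pose x_of (s : state R pp) := vec_x alpha beta s.
pose y_of (s : state R pp) := vec_y alpha beta s.
pose start s := [/\
  lattice [tuple x_of s; y_of s] = lattice [tuple alpha; beta],
  lin_indep [tuple x_of s; y_of s], N (x_of s) <= N (y_of s) &
  scalars s 4 = 1 /\ reals s 0 <= reals s 2].
apply: (@reaches_cat _ _ _ _ _ _ _ _ _ _ start).
  do 2 apply: reaches_norm; apply: reaches_if => /=.
  rewrite /update /= /vector /= !scale1r !scale0r addr0 add0r.
  case: ifP => [le|/negbT]; last rewrite -ltNge => /ltW le;
    do 3 apply: reaches_assign; apply: reaches_nil.
    by split; rewrite /x_of /y_of /vec_x /vec_y /vector /update //=;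
      rewrite !scale1r !scale0r addr0 add0r.
  split; rewrite /x_of /y_of /vec_x /vec_y /vector /update //=;
      rewrite !scale1r !scale0r addr0 add0r //.
    exact: lattice2C.
  exact: lin_indep2C.
move=> s [sL sind sle [s4 s02]]; move: sL sind sle.
move sx : (x_of s) => x; move sy : (y_of s) => y sL sind sle.
(* No x + m y with m an integer is as short as p^K y, so the test cannot succeed from round [K]
   on. *)
have [K xK] := dist_line_gt0 normN sind.
(* A successful test supplies the hypothesis for another round, a failed one the minimality needed
   at exit. *)
pose J k t := exists2 m : int, x_of t = x + m%:~R *: y &
  [/\ y_of t = y, scalars t 4 = p%:R ^+ k,
  reals t 0 <= reals t 2 -> N (x_of t) <= N (p%:R ^+ k *: y) &
  reals t 2 < reals t 0 -> forall b, N (x_of t) <= N (x + b *: y)].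
apply: (@reaches_while _ _ _ _ _ _ _ _ _ _ _ J K).
- move=> k t [m tx [ty t4 tle _]] /= tt; split.
    rewrite ltnNge; apply/negP => /(normXp_le normN y) /le_lt_trans /(_ (xK m)).
    by rewrite -tx ltNge tle.
  apply: reaches_weaken (reduce_correct N alpha beta t4) _ => u.
  move=> [[c ux] u_min uy [u4 u0 u2]].
  rewrite -!/(x_of _) -!/(y_of _) in ux u_min uy u0 u2.
  (* The new coefficient m + c p^k is again an integer, so the lattice is kept. *)
  rewrite ty in ux u_min uy u2; exists (m + (c * p ^ k)%N%:Z).
    by rewrite ux tx rmorphD /= scalerDl addrA -pmulrn natrM natrX.
  split=> //; first by rewrite u0 u2.
  rewrite u0 u2 => lt b.
  (* The lines in direction y through x and through the current vector coincide. *)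
  have -> : x + b *: y = x_of t + (b - m%:~R) *: y.
    by rewrite tx -addrA -scalerDl subrKC.
  apply: (norm_min_line normN (tle tt) lt) => // d /ltnW; exact: u_min.
- move=> k t [m tx [ty _ _]] /=; rewrite -ltNge => H /H t_min.
  rewrite -sL -(lattice2_shear x y m) /output.
  rewrite -[vector _ _ _ _ _]/(x_of t) -[X in [tuple _; X]]/(y_of t) tx ty.
  apply: lattice2_orthogonal => //; first exact: lin_indep2_shear.
  by move=> b; rewrite -addrA -scalerDl -tx; exact: t_min.
exists 0; first by rewrite scale0r addr0.
split=> //; first by rewrite expr0 scale1r sx.
(* On entry the test is true, so the exit clause of [J] is vacuous. *)
by move=> lt; move: s02; rewrite leNgt lt.
Qed.
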